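(* Let $b,\bar m,r\ge1$ be integers. Let the prior be a finite mixture of factorized categorical distributions, $$\mathbf{p}=\sum_{i=1}^r\alpha_i\bigotimes_{j=1}^b\mathbf{p}_j^{(i)}\in\mathbb{R}^{\bar m^b},$$ where $\boldsymbol{\alpha}\in(0,1)^r$ is a vector of mixture probabilities ($\sum_i\alpha_i=1$) and each $\mathbf{p}_j^{(i)}\in(0,1)^{\bar m}$ is a probability vector (entries summing to $1$). Let the variational distribution factorize, $\mathbf{q}=\bigotimes_{j=1}^b\mathbf{q}_j$, with probability vectors $\mathbf{q}_j\in(0,1)^{\bar m}$ (entries summing to $1$). Then $$\mathbf{q}^T\log\mathbf{p}\;\ge\;\sum_{i=1}^r\alpha_i\sum_{j=1}^b\mathbf{q}_j^T\log\mathbf{p}_j^{(i)}.$$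
   Context: $\otimes$ is the Kronecker product; logarithms of vectors are elementwise. *)

(* Defs.v *)
From mathcomp Require Import all_boot all_order all_algebra.
From mathcomp Require Import mxtens.
From mathcomp Require Import reals exp.
Set Implicit Arguments.
Unset Strict Implicit.
Unset Printing Implicit Defensive.
Import Order.TTheory GRing.Theory Num.Theory.
Local Open Scope ring_scope.

Definition open_prob_vector (R : realType) (n : nat) (v : 'cV[R]_n) : Prop :=
  (forall k : 'I_n, 0 < v k 0 < 1) /\ \sum_(k < n) v k 0 = 1.

(* v_0 *t (v_1 *t (... *t v_(b-1))): the factor of index 0 carries the most
   significant digit of the row index. *)
Fixpoint kronecker_prod (R : realType) (m b : nat) :
    ('I_b -> 'cV[R]_m) -> 'cV[R]_(m ^ b) :=
  match b return ('I_b -> 'cV[R]_m) -> 'cV[R]_(m ^ b) with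
  | 0 => fun _ => const_mx 1
  | k.+1 => fun v =>
      castmx (esym (expnS m k), muln1 1)
        (v ord0 *t kronecker_prod (fun j : 'I_k => v (lift ord0 j)))
  end.

Definition log_vec (R : realType) (n : nat) (v : 'cV[R]_n) : 'cV[R]_n :=
  map_mx (@ln R) v.

Definition dotv (R : realType) (n : nat) (u v : 'cV[R]_n) : R :=
  (u^T *m v) 0 0.

(* Main.v *)
(* Jensen's inequality for the concave logarithm, applied to each entry of the
   mixture, bounds q^T log p below by the alpha-average of the q^T log p^(i).
   For factorized p^(i), log turns the Kronecker product into a sum over the
   factors, and averaging each summand against q leaves only the marginal q_j,
   since the other marginals have total mass 1. *)
Require Import Defs.
From mathcomp Require Import all_boot all_order all_algebra.
From mathcomp Require Import mxtens.
From mathcomp Require Import reals exp.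
Import Order.TTheory GRing.Theory Num.Theory.
Local Open Scope ring_scope.

Lemma jensen_ln (R : realType) (r : nat) (a x : 'I_r -> R) :
  (forall i, 0 < a i) -> \sum_i a i = 1 -> (forall i, 0 < x i) ->
  \sum_i a i * ln (x i) <= ln (\sum_i a i * x i).
Proof.
move=> a_gt0 a_sum x_gt0; set S := \sum_i a i * x i.
have S_gt0 : 0 < S.
  (* The weights sum to 1, so the index set cannot be empty. *)
  have r_gt0 : (0 < r)%N.
    case: r a x a_gt0 a_sum x_gt0 @S => // a x _ + _ _.
    by rewrite big_ord0 => /esym/eqP; rewrite oner_eq0.
  rewrite /S (bigD1 (Ordinal r_gt0)) //= ltr_pwDl ?mulr_gt0 //.
  by apply: sumr_ge0 => i _; rewrite ltW ?mulr_gt0.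
rewrite -subr_le0 -[ln S]mul1r -a_sum mulr_suml -sumrB.
(* The tangent-line bound ln y <= y - 1, averaged at y = x i / S. *)
have sum0 : \sum_i a i * (x i / S - 1) = 0.
  under eq_bigr do rewrite mulrBr mulr1 mulrA.
  by rewrite sumrB -mulr_suml a_sum divff ?subrr // gt_eqF.
rewrite -[leRHS]sum0; apply: ler_sum => i _.
rewrite -mulrBr ler_pM2l // -ln_div ?posrE //.
rewrite lerBrDl; have := @expR_ge1Dx R (ln (x i / S)).
by rewrite lnK // posrE divr_gt0.
Qed.

(** [mxtens_index], up to a cast, is a bijection from pairs (leading digit, remaining index) to row
    indices. Keeping [F] abstract lets one reindexing serve both the total mass and the sums of
    [x * ln y]. *)
Lemma sum_kronecker_prodS (R : realType) (m b : nat) (F : R -> R -> R)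
    (u v : 'I_b.+1 -> 'cV[R]_m) :
  \sum_k F (kronecker_prod u k 0) (kronecker_prod v k 0) =
  \sum_i \sum_k
    F (u ord0 i 0 * kronecker_prod (fun j => u (lift ord0 j)) k 0)
      (v ord0 i 0 * kronecker_prod (fun j => v (lift ord0 j)) k 0).
Proof.
rewrite pair_big /=.
have tensE A (w : 'cV[R]_(m ^ b)) i k :
    (A : 'cV[R]_m) i 0 * w k 0 =
    castmx (esym (expnS m b), muln1 1) (A *t w)
      (cast_ord (esym (expnS m b)) (mxtens_index (i, k))) 0.
  by rewrite castmxE mxE cast_ordK mxtens_indexK /= !ord1.
rewrite (reindex (fun p => cast_ord (esym (expnS m b)) (mxtens_index p))) /=.
  by apply: eq_bigr => -[i k] _; rewrite !tensE.
exists (fun k => mxtens_unindex (cast_ord (expnS m b) k)) => k _.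
  by rewrite cast_ordKV mxtens_indexK.
by rewrite mxtens_unindexK cast_ordK.
Qed.

Lemma kronecker_prod_gt0 (R : realType) (m b : nat) (v : 'I_b -> 'cV[R]_m) k :
  (forall j i, 0 < v j i 0) -> 0 < kronecker_prod v k 0.
Proof.
elim: b v k => [|b IHb] v k v_gt0 /=; first by rewrite mxE ltr01.
by rewrite castmxE mxE mulr_gt0 ?ord1 ?IHb.
Qed.

Lemma sum_kronecker_prod (R : realType) (m b : nat) (v : 'I_b -> 'cV[R]_m) :
  \sum_k kronecker_prod v k 0 = \prod_j \sum_i v j i 0.
Proof.
elim: b v => [|b IHb] v; first by rewrite big_ord0 big_ord1 mxE.
rewrite (@sum_kronecker_prodS _ _ _ (fun x _ => x) v v) big_ord_recl -IHb.
by rewrite mulr_suml; apply: eq_bigr => i _; rewrite mulr_sumr.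
Qed.

Lemma dotv_log_vec (R : realType) (n : nat) (u v : 'cV[R]_n) :
  dotv u (log_vec v) = \sum_k u k 0 * ln (v k 0).
Proof. by rewrite /dotv mxE; apply: eq_bigr => k _; rewrite !mxE. Qed.

Lemma dotv_log_kronecker_prod (R : realType) (m b : nat)
    (u v : 'I_b -> 'cV[R]_m) :
  (forall j, \sum_i u j i 0 = 1) -> (forall j i, 0 < v j i 0) ->
  dotv (kronecker_prod u) (log_vec (kronecker_prod v)) =
  \sum_j dotv (u j) (log_vec (v j)).
Proof.
elim: b u v => [|b IHb] u v u_sum v_gt0.
  (* The empty Kronecker product has the single entry 1, whose logarithm is 0. *)
  by rewrite big_ord0 dotv_log_vec big_ord1 !mxE ln1 mulr0.
rewrite dotv_log_vec (@sum_kronecker_prodS _ _ _ (fun x y => x * ln y)).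
set u' := fun j => u (lift ord0 j); set v' := fun j => v (lift ord0 j).
have u'_sum : \sum_k kronecker_prod u' k 0 = 1.
  by rewrite sum_kronecker_prod big1 // => j _; apply: u_sum.
rewrite big_ord_recl -IHb => [|j|j i]; [|exact: u_sum|exact: v_gt0].
(* Marginalization read backwards: the tail term is multiplied by the mass 1 of [u ord0], and then
   the head term by the mass 1 of the tail product. Both sides become double sums, compared termwise
   through [lnM]. *)
rewrite !dotv_log_vec -[X in _ + X]mul1r -(u_sum ord0) mulr_suml -big_split /=.
apply: eq_bigr => i _; rewrite -[X in X + _]mul1r -u'_sum mulr_suml mulr_sumr.
rewrite -big_split /=; apply: eq_bigr => k _.
rewrite lnM ?posrE ?kronecker_prod_gt0 // => [|j ?]; last exact: v_gt0.
by rewrite mulrDr mulrA [X in X * _ + _]mulrC -!mulrA.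
Qed.

Theorem theorem4 (R : realType) (b mbar r : nat)
  (hb : (1 <= b)%N) (hm : (1 <= mbar)%N) (hr : (1 <= r)%N)
  (alpha : 'cV[R]_r) (halpha : open_prob_vector alpha)
  (pij : 'I_r -> 'I_b -> 'cV[R]_mbar)
  (hpij : forall (i : 'I_r) (j : 'I_b), open_prob_vector (pij i j))
  (p : 'cV[R]_(mbar ^ b))
  (hp : p = \sum_(i < r) alpha i 0 *: kronecker_prod (pij i))
  (qj : 'I_b -> 'cV[R]_mbar)
  (hqj : forall j : 'I_b, open_prob_vector (qj j))
  (q : 'cV[R]_(mbar ^ b)) (hq : q = kronecker_prod qj) :
  dotv q (log_vec p) >=
    \sum_(i < r) alpha i 0 * \sum_(j < b) dotv (qj j) (log_vec (pij i j)).
Proof.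
have [alpha01 alpha_sum] := halpha.
have alpha_gt0 i : 0 < alpha i 0 by case/andP: (alpha01 i).
have pij_gt0 i j k : 0 < pij i j k 0 by case/andP: ((hpij i j).1 k).
have qj_gt0 j k : 0 < qj j k 0 by case/andP: ((hqj j).1 k).
(* Undoing the factorization writes each mixture component as a sum over the entries of [q], the
   form that the left side has. *)
under eq_bigr => i _.
  rewrite -(dotv_log_kronecker_prod _ _ _ _ _ (fun j => (hqj j).2) (pij_gt0 i)).
  rewrite dotv_log_vec mulr_sumr.
  over.
rewrite {}hp {}hq dotv_log_vec exchange_big /=; apply: ler_sum => k _.
(* The positive weight of entry [k] in [q] is common to both sides; cancelling it leaves Jensen's
   inequality at that entry. *)
under eq_bigr do rewrite mulrCA.
rewrite -mulr_sumr ler_pM2l ?kronecker_prod_gt0 // summxE.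
under [X in _ <= ln X]eq_bigr do rewrite mxE.
by apply: jensen_ln => // i; apply: kronecker_prod_gt0.
Qed.
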